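(* Let $A$ be a ring, let $G$ be a group, let $S$ be a submonoid of $G$ with $G=S^{-1}S$, and let $\alpha:S\to \mathrm{Endr}(A)$, $s\mapsto\alpha_s$, be an action of $S$ on $A$ by corner isomorphisms; write $p_s=\alpha_s(1)$. Assume that $A$ is a simple, strictly unperforated ring in which every nonzero right ideal (equivalently, every nonzero left ideal) contains a nonzero idempotent. Assume also that $\alpha$ is outer, and that there exists $u\in S$ with $p_u\neq 1$. Then $R=S^{\mathrm{op}}*_\alpha A*_\alpha S$ is a purely infinite simple ring.
   Context: All rings are unital. $\mathrm{Endr}(A)$ is the monoid (under composition) of not necessarily unital ring endomorphisms of $A$. $G=S^{-1}S$ means every element of $G$ has the form $s^{-1}t$ with $s,t\in S$. An action $\alpha$ of $S$ on $A$ by corner isomorphisms is a monoid homomorphism $\alpha:S\to\mathrm{Endr}(A)$ such that for each $s\in S$, with $p_s:=\alpha_s(1)$ (an idempotent), $\alpha_s$ is an isomorphism of $A$ onto the corner ring $p_sAp_s$ (in particular $\alpha_s$ is injective). The ring $R=S^{\mathrm{op}}*_\alpha A*_\alpha S$ is the unital ring equipped with a unital ring homomorphism $\phi:A\to R$ and monoid homomorphisms $s\mapsto s_-$ from $S^{\mathrm{op}}$ to $R$ (so $(su)_-=u_-s_-$, $1_-=1$) and $t\mapsto t_+$ from $S$ to $R$ (to the multiplicative monoid of $R$), universal with respect to the relations: (1) $t_+\phi(a)=\phi(\alpha_t(a))t_+$ for $a\in A$, $t\in S$; (2) $\phi(a)s_-=s_-\phi(\alpha_s(a))$ for $a\in A$,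 $s\in S$; (3) $s_-s_+=1$ for $s\in S$; (4) $s_+s_-=\phi(p_s)$ for $s\in S$. A pair $(\alpha_s,\alpha_t)$ with $s,t\in S$ is inner if there exist $u\in p_sAp_t$ and $v\in p_tAp_s$ such that $uv=p_s$, $vu=p_t$ and $\alpha_s(x)=u\alpha_t(x)v$ for all $x\in A$. The action $\alpha$ is outer if $(\alpha_s,\alpha_t)$ is not inner for any distinct $s,t\in S$. For modules, $X\prec Y$ means that $X$ is isomorphic to a proper direct summand of $Y$, and $mX$ is the direct sum of $m$ copies of $X$. A ring $T$ is strictly unperforated if for all finitely generated projective right (equivalently left) $T$-modules $P,Q$ and all integers $m\ge 1$, $mP\prec mQ$ implies $P\prec Q$. A simple ring $T$ is purely infinite if every nonzero right ideal of $T$ contains an infinite idempotent, i.e. an idempotent $e$ such that $eT$ is isomorphic to a proper direct summand of itself. (Known equivalent characterization: $T$ is not a division ring, and for every nonzero $a\in T$ there exist $x,y\in T$ with $xay=1$.) *)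

(* Defs.v *)
From HB Require Import structures.
From mathcomp Require Import all_boot all_order all_algebra all_classical.

Set Implicit Arguments.
Unset Strict Implicit.
Unset Printing Implicit Defensive.

Import GRing.Theory.

Local Open Scope ring_scope.

(* Rings are unital, not necessarily commutative and possibly zero: pzRingType.
   A right T-module is a module over the converse ring T^c, the right action
   of a on x being a *: x; the regular right module is T^c^o, for which
   a *: x is the product x * a computed in T.  Submodules and ideals are
   boolean predicates, which is no restriction in the presence of asbool. *)

Notation rmodType T := (lmodType T^c).
Notation right_regular T := (T^c^o).

Section Modules.
Variable T : pzRingType.
Implicit Types P Q X Y : lmodType T.

Definition finitely_generated P : Prop :=
  exists (n : nat) (e : 'I_n -> P),
    forall x : P, exists c : 'I_n -> T, x = \sum_(i < n) c i *: e i.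

Definition projective P : Prop :=
  forall (M N : lmodType T) (g : {linear M -> N}) (f : {linear P -> N}),
    (forall y : N, exists x : M, g x = y) ->
    exists h : {linear P -> M}, forall x : P, g (h x) = f x.

Definition isomorphic_to_submodule X Y (M : {pred Y}) : Prop :=
  exists f : {linear X -> Y},
    injective f /\ (forall y : Y, y \in M <-> exists x : X, f x = y).

Definition direct_summand Y (M : {pred Y}) : Prop :=
  GRing.submod_closed M /\
  exists N : {pred Y},
    [/\ GRing.submod_closed N,
        forall y : Y, exists a b : Y, [/\ a \in M, b \in N & y = a + b] &
        forall y : Y, y \in M -> y \in N -> y = 0].

Definition proper_direct_summand Y (M : {pred Y}) : Prop :=
  direct_summand M /\ exists y : Y, y \notin M.

(* X is isomorphic to a proper direct summand of Y. *)
Definition prec X Y : Prop :=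
  exists M : {pred Y}, proper_direct_summand M /\ isomorphic_to_submodule X M.

Definition copies (m : nat) X : lmodType T := {ffun 'I_m -> X}.

End Modules.

Definition strictly_unperforated (T : pzRingType) : Prop :=
  forall (P Q : rmodType T) (m : nat),
    finitely_generated P -> projective P ->
    finitely_generated Q -> projective Q ->
    (1 <= m)%N -> prec (copies m P) (copies m Q) -> prec P Q.

Section Ideals.
Variable T : pzRingType.
Implicit Types (I : {pred T}) (e : T).

Definition left_ideal I : Prop := GRing.submod_closed (I : {pred T^o}).

Definition right_ideal I : Prop :=
  GRing.submod_closed (I : {pred right_regular T}).

Definition two_sided_ideal I : Prop := left_ideal I /\ right_ideal I.

Definition nonzero_ideal I : Prop := exists2 x : T, x \in I & x != 0.

Definition simple_ring : Prop :=
  (1 : T) != 0 /\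
  forall I, two_sided_ideal I -> nonzero_ideal I -> forall x : T, x \in I.

Definition idempotent e : Prop := e * e = e.

Definition right_ideals_have_idempotents : Prop :=
  forall I, right_ideal I -> nonzero_ideal I ->
  exists e : T, [/\ e \in I, e != 0 & idempotent e].

Definition principal_right e : {pred right_regular T} :=
  fun x => `[< exists a : T, x = e * a >].

Lemma principal_right_submod_closed e : GRing.submod_closed (principal_right e).
Proof.
split; first by apply/asboolP; exists 0; rewrite mulr0.
move=> a u v /asboolP[x ->] /asboolP[y ->]; apply/asboolP.
by exists (x * a + y); rewrite mulrDr mulrA.
Qed.

HB.instance Definition _ e :=
  GRing.isSubmodClosed.Build T^c (right_regular T) (principal_right e)
    (principal_right_submod_closed e).

(* The right ideal e * T as a right T-module. *)
Record principal_right_module e := PrincipalRight {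
  principal_right_val :> right_regular T;
  _ : principal_right_val \in principal_right e
}.

HB.instance Definition _ e := [isSub for @principal_right_val e].
HB.instance Definition _ e := [Choice of principal_right_module e by <:].
HB.instance Definition _ e :=
  [SubChoice_isSubLmodule of principal_right_module e by <:].

Definition infinite_idempotent e : Prop :=
  idempotent e /\
  @prec T^c (principal_right_module e) (principal_right_module e).

Definition purely_infinite_simple : Prop :=
  simple_ring /\
  forall I, right_ideal I -> nonzero_ideal I ->
  exists2 e : T, e \in I & infinite_idempotent e.

End Ideals.

(* p T q *)
Definition corner (T : pzRingType) (p q : T) : set T :=
  [set x | exists a : T, x = p * a * q].

Section CornerActions.
Variables (A : pzRingType) (S : monoidType) (alpha : S -> {additive A -> A}).

(* alpha is a monoid morphism from S to the not necessarily unital ring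
   endomorphisms of A; p_s is alpha s 1. *)
Record corner_action : Prop := CornerAction {
  corner_action_mul : forall s, {morph alpha s : x y / x * y};
  corner_action_one : forall x, alpha 1%g x = x;
  corner_action_comp : forall s t x, alpha (s * t)%g x = alpha s (alpha t x);
  corner_action_inj : forall s, injective (alpha s);
  corner_action_image : forall s,
    range (alpha s) = corner (alpha s 1) (alpha s 1)
}.

Definition inner_pair (s t : S) : Prop :=
  exists u v : A,
    [/\ corner (alpha s 1) (alpha t 1) u, corner (alpha t 1) (alpha s 1) v,
        u * v = alpha s 1, v * u = alpha t 1 &
        forall x : A, alpha s x = u * alpha t x * v].

Definition outer_action : Prop := forall s t : S, s != t -> ~ inner_pair s t.

Record skew_relations (R : pzRingType) (phi : {rmorphism A -> R})
    (minus plus : S -> R) : Prop := SkewRelations {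
  skew_minus1 : minus 1%g = 1;
  skew_minusM : forall s u, minus (s * u)%g = minus u * minus s;
  skew_plus1 : plus 1%g = 1;
  skew_plusM : forall s t, plus (s * t)%g = plus s * plus t;
  skew_plusE : forall t a, plus t * phi a = phi (alpha t a) * plus t;
  skew_minusE : forall s a, phi a * minus s = minus s * phi (alpha s a);
  skew_minus_plus : forall s, minus s * plus s = 1;
  skew_plus_minus : forall s, plus s * minus s = phi (alpha s 1)
}.

(* (R, phi, minus, plus) is the ring S^op *_alpha A *_alpha S: an initial
   object among rings with such data, which is unique up to isomorphism. *)
Definition is_skew_monoid_ring (R : pzRingType) (phi : {rmorphism A -> R})
    (minus plus : S -> R) : Prop :=
  skew_relations phi minus plus /\
  forall (R' : pzRingType) (phi' : {rmorphism A -> R'})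
         (minus' plus' : S -> R'),
    skew_relations phi' minus' plus' ->
    exists f : {rmorphism R -> R'},
      let compatible (g : {rmorphism R -> R'}) :=
        [/\ forall a, g (phi a) = phi' a,
            forall s, g (minus s) = minus' s &
            forall t, g (plus t) = plus' t] in
      compatible f /\ forall g : {rmorphism R -> R'}, compatible g -> g =1 f.

End CornerActions.

(* Main.v *)
(* Every element of [R] becomes, after multiplication on the left by some [plus s], a
   polynomial [sum phi(a_t) plus(t)].  Outerness provides [b, c] in [A] such that
   multiplication by [phi b] and [phi c] kills all its terms but one, so every
   [r != 0] has a multiple [x r y = phi e] with [e] a nonzero idempotent of [A].
   As [p_u <> 1], the units [p_(u^n)] become arbitrarily small: strict unperforation
   gives [p_s] equivalent to an idempotent below [e], and [minus s], [plus s] turn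
   [phi p_s] into [1].  Hence [x r y = 1] is always solvable; [minus u] and [plus u] make
   [1] an infinite idempotent.  That [R] is nonzero is seen on an explicit module of
   germs of functions with values in [A]. *)
Require Import Defs.
From HB Require Import structures.
From mathcomp Require Import all_boot all_order all_algebra all_classical.

Set Implicit Arguments.
Unset Strict Implicit.
Unset Printing Implicit Defensive.

Import GRing.Theory.

Local Open Scope ring_scope.

(** * Simple rings with many idempotents *)

Section SimpleRings.
Variable T : pzRingType.
Implicit Types a b e h q x y : T.

Lemma two_sided_idealI (I : {pred T}) :
  0 \in I -> {in I &, forall x y, x + y \in I} ->
  (forall a, {in I, forall x, a * x \in I}) ->
  (forall a, {in I, forall x, x * a \in I}) -> two_sided_ideal I.
Proof.
move=> I0 ID IMl IMr; split; split=> // a u v uI vI; apply: ID => //.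
- exact: IMl.
- exact: IMr.
Qed.

(** These sums form a two-sided ideal containing [q]. *)
Lemma simple_sum q : simple_ring T -> q != 0 ->
  exists l : seq (T * T), 1 = \sum_(p <- l) p.1 * q * p.2.
Proof.
case=> _ simT q0.
pose I : {pred T} := fun z =>
  `[< exists l : seq (T * T), z = \sum_(p <- l) p.1 * q * p.2 >].
suff: 1 \in I by move/asboolP.
apply: simT; last first.
  by exists q => //; apply/asboolP; exists [:: (1, 1)]; rewrite big_seq1 mul1r mulr1.
apply: two_sided_idealI.
- by apply/asboolP; exists [::]; rewrite big_nil.
- move=> _ _ /asboolP[l ->] /asboolP[l' ->]; apply/asboolP.
  by exists (l ++ l'); rewrite big_cat.
- move=> a _ /asboolP[l ->]; apply/asboolP.
  exists [seq (a * p.1, p.2) | p <- l]; rewrite big_map mulr_sumr.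
  by apply: eq_bigr => p _; rewrite !mulrA.
- move=> a _ /asboolP[l ->]; apply/asboolP.
  exists [seq (p.1, p.2 * a) | p <- l]; rewrite big_map mulr_suml.
  by apply: eq_bigr => p _; rewrite !mulrA.
Qed.

(** If [1] is written as a sum of terms [r * a * x] and multiplied by [b], some term must
    survive. *)
Lemma simple_prime a b : simple_ring T -> a != 0 -> b != 0 ->
  exists x, a * x * b != 0.
Proof.
move=> simT a0 b0; have [l l1] := simple_sum simT a0.
apply: contrapT => nx; move/eqP: b0; apply.
rewrite -[b]mul1r l1 mulr_suml big1 // => p _.
rewrite -!mulrA [a * _]mulrA.
have [->|ne] := eqVneq (a * p.2 * b) 0; first by rewrite mulr0.
by case: nx; exists p.2.
Qed.

Lemma idempotent_right_multiple x : right_ideals_have_idempotents T -> x != 0 ->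
  exists y, x * y != 0 /\ x * y * (x * y) = x * y.
Proof.
move=> idT x0; have [||e [/asboolP[y ->] ne ee]] := idT (principal_right x).
- exact: principal_right_submod_closed.
- by exists x => //; apply/asboolP; exists 1; rewrite mulr1.
by exists y.
Qed.

(** The hypothesis on right ideals passes to left ones: if [x * y] is idempotent, so is
    [y * (x * y) * x], and multiplying the latter by [x] on the left and [y] on the right recovers
    [x * y]. *)
Lemma idempotent_left_multiple x : right_ideals_have_idempotents T -> x != 0 ->
  exists y, y * x != 0 /\ y * x * (y * x) = y * x.
Proof.
move=> idT /(idempotent_right_multiple idT)[y [ne ee]].
exists (y * x * y); split; last first.
  have -> : y * x * y * x = y * (x * y) * x by rewrite !mulrA.
  have -> : y * (x * y) * x * (y * (x * y) * x) = 
    y * (x * y * (x * y) * (x * y)) * x by rewrite !mulrA.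
  by rewrite !ee.
apply: contra_neq ne => yx0.
have -> : x * y = x * (y * x * y * x) * y by rewrite !mulrA -!(mulrA (x * y)) !ee.
by rewrite yx0 mulr0 mul0r.
Qed.

(* [g + g z (1 - g)] is an idempotent of [T a] as well, so if every idempotent
   [y a] had [y b = 0], then [g T b = 0]. *)
Lemma idempotent_left_multiple_separating a b :
  simple_ring T -> right_ideals_have_idempotents T ->
  (forall y, y * a = 0 -> y * b = 0) -> b != 0 ->
  exists y, y * a * (y * a) = y * a /\ y * b != 0.
Proof.
move=> simT idT ab b0.
have a0 : a != 0.
  by apply: contra_neq b0 => a0; rewrite -[b]mul1r ab // mul1r.
have [y [ne ee]] := idempotent_left_multiple idT a0.
have [yb|] := eqVneq (y * b) 0; last by exists y.
have [x nx] := simple_prime simT ne b0.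
set g := y * a in ne ee nx.
(* This multiplier sends [a] to [g + g z (1 - g)] with [z = x * a], and [b] to [g * x * b], because
   [y * b = 0]. *)
exists (y + g * x - g * x * a * y); split; last first.
  by rewrite mulrBl mulrDl yb add0r -(mulrA _ y) yb mulr0 subr0.
have -> : (y + g * x - g * x * a * y) * a = g + g * (x * a - x * a * g).
  by rewrite mulrBl mulrDl -/g mulrBr -!mulrA -/g addrA.
have gw : g * (g * (x * a - x * a * g)) = g * (x * a - x * a * g).
  by rewrite mulrA ee.
have wg : g * (x * a - x * a * g) * g = 0.
  by rewrite -mulrA mulrBl -(mulrA _ g g) ee subrr mulr0.
move: (g * (x * a - x * a * g)) gw wg => w gw wg.
have ww : w * w = 0 by rewrite -[X in _ * X]gw mulrA wg mul0r.
by rewrite mulrDl !mulrDr ee gw wg ww !addr0.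
Qed.

(* With [l = h - k], the off-diagonal Peirce component [k x l] is the difference
   of the idempotents [k + k x l] and [k], and by simplicity the diagonal
   components are sums of products of off-diagonal ones. *)
Lemma corner_generated_by_idempotents (E : T -> Prop) h k : simple_ring T ->
  h * h = h -> k * k = k -> h * k = k -> k * h = k -> k != 0 -> k != h ->
  (forall c, c * c = c -> h * c = c -> c * h = c -> E c) ->
  (forall x y, E x -> E y -> E (x - y)) ->
  (forall x y, E x -> E y -> E (x * y)) ->
  forall x, h * x * h = x -> E x.
Proof.
move=> simT hh kk hk kh k0 kNh Eidem EB EM.
have E0 : E 0 by apply: Eidem; rewrite ?(mulr0, mul0r).
have EN x : E x -> E (- x) by move=> Ex; rewrite -sub0r; apply: EB.
have ED x y : E x -> E y -> E (x + y).
  by move=> Ex Ey; rewrite -[y]opprK; apply: EB => //; apply: EN.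
have Eoff c d x : c * c = c -> h * c = c -> c * h = c ->
    d * c = 0 -> h * d = d -> d * h = d -> E (c * x * d).
  move=> cc hc ch dc hd dh.
  have -> : c * x * d = (c + c * x * d) - c by rewrite addrC addKr.
  apply: EB; apply: Eidem => //.
  - rewrite mulrDl !mulrDr cc !mulrA cc -!(mulrA (c * x)) dc.
    by rewrite !(mul0r, mulr0) !addr0.
  - by rewrite mulrDr !mulrA hc.
  - by rewrite mulrDl -mulrA dh ch.
have Ediag c d x : c * c = c -> h * c = c -> c * h = c -> d * c = 0 ->
    c * d = 0 -> h * d = d -> d * h = d -> d * d = d -> d != 0 -> E (c * x * c).
  move=> cc hc ch dc cd hd dh dd d0; have [s s1] := simple_sum simT d0.
  have -> : c * x * c = \sum_(p <- s) (c * (x * p.1) * d) * (d * p.2 * c).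
    rewrite -[x in LHS]mulr1 s1 mulr_sumr mulr_sumr mulr_suml.
    by apply: eq_bigr => p _; rewrite !mulrA -(mulrA _ d d) dd.
  by elim/big_ind: _ => // p _; apply: EM; apply: Eoff.
pose l := h - k.
have l0 : l != 0 by rewrite subr_eq0 eq_sym.
have hl : h * l = l by rewrite mulrBr hh hk.
have lh : l * h = l by rewrite mulrBl hh kh.
have lk : l * k = 0 by rewrite mulrBl hk kk subrr.
have kl : k * l = 0 by rewrite mulrBr kh kk subrr.
have ll : l * l = l by rewrite {2}/l mulrBr lh lk subr0.
have hE : h = k + l by rewrite /l addrC subrK.
move=> x <-; clearbody l; rewrite [in X in E X]hE.
rewrite !mulrDl !mulrDr.
by apply: (ED); apply: (ED); first [exact: (Ediag k l) | exact: (Ediag l k) | exact: Eoff].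
Qed.

End SimpleRings.

(** * Direct summands of principal modules *)

(** [Y] is the direct sum of the image of [f] and the kernel of [g]; the latter contains [y]. *)
Lemma prec_of_retraction (T : pzRingType) (X Y : lmodType T)
    (f : {linear X -> Y}) (g : {linear Y -> X}) (y : Y) :
  cancel f g -> y != 0 -> g y = 0 -> prec X Y.
Proof.
move=> fK y0 gy.
pose M : {pred Y} := fun z => `[< exists x, f x = z >].
pose N : {pred Y} := fun z => `[< g z = 0 >].
exists M; split; last first.
  exists f; split=> [|z]; first exact: can_inj fK.
  by split=> [/asboolP|?]; last apply/asboolP.
split; last first.
  exists y; apply/asboolP => -[x fx]; move/eqP: y0; apply.
  by rewrite -fx -(fK x) fx gy raddf0.
split; last exists N; split.
- by apply/asboolP; exists 0; rewrite raddf0.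
- move=> a _ _ /asboolP[x <-] /asboolP[x' <-]; apply/asboolP.
  by exists (a *: x + x'); rewrite linearP.
- split; first by apply/asboolP; rewrite raddf0.
  move=> a u v /asboolP gu /asboolP gv; apply/asboolP.
  by rewrite linearP gu gv scaler0 addr0.
- move=> z; exists (f (g z)), (z - f (g z)); split.
  + by apply/asboolP; exists (g z).
  + by apply/asboolP; rewrite linearB /= fK subrr.
  + by rewrite addrC subrK.
- by move=> _ /asboolP[x <-] /asboolP; rewrite fK => ->; rewrite raddf0.
Qed.

Section PrincipalModules.
Variable T : pzRingType.
Implicit Types e p x y : T.

Lemma principal_right_mul e x : e * x \in principal_right e.
Proof. by apply/asboolP; exists x. Qed.

Definition to_principal e x : principal_right_module e :=
  PrincipalRight (principal_right_mul e x).

(** Typing the value in [T], not in the regular module over [T^c], makes products read in the order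
    of [T]. *)
Definition from_principal e (z : principal_right_module e) : T :=
  principal_right_val z.

Lemma to_principalK e x : from_principal (to_principal e x) = e * x.
Proof. by []. Qed.

Lemma from_principal_inj e : injective (@from_principal e).
Proof. exact: val_inj. Qed.

Lemma from_principal_linear e (a : T) (u v : principal_right_module e) :
  from_principal ((a : T^c) *: u + v) = from_principal u * a + from_principal v.
Proof. by []. Qed.

Lemma from_principalZ e (a : T) (u : principal_right_module e) :
  from_principal ((a : T^c) *: u) = from_principal u * a.
Proof. by []. Qed.

Lemma from_principalE e (z : principal_right_module e) :
  e * e = e -> e * from_principal z = from_principal z.
Proof.
by move=> ee; case: z => z zP /=; case/asboolP: (zP) => a /= ->; rewrite mulrA ee.
Qed.

Lemma principal_right_finitely_generated e : e * e = e ->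
  finitely_generated (principal_right_module e).
Proof.
move=> ee; exists 1%N, (fun=> to_principal e 1) => z; exists (fun=> from_principal z).
rewrite big_ord1; apply: from_principal_inj.
by rewrite from_principalZ to_principalK mulr1 from_principalE.
Qed.

Lemma principal_right_projective e : e * e = e ->
  projective (principal_right_module e).
Proof.
move=> ee M N g f g_surj; have [m gm] := g_surj (f (to_principal e 1)).
pose h (z : principal_right_module e) : M := (from_principal z : T^c) *: m.
have h_lin : linear h.
  by move=> a u v; rewrite /h from_principal_linear scalerDl -scalerA.
pose H := GRing.isLinear.Build _ _ _ _ h h_lin.
pose hh : {linear principal_right_module e -> M} := HB.pack h H.
exists hh => z; rewrite /= /h linearZ /= gm -linearZ; congr (f _).
apply: from_principal_inj; by rewrite from_principalZ to_principalK mulr1 from_principalE.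
Qed.

(** * Homomorphisms given by matrices *)

Section Matrices.
Variables (n : nat) (e : T) (X : 'I_n -> 'I_n -> T) (p : T).

Definition principal_mx (v : copies n (principal_right_module p)) :
    copies n (principal_right_module e) :=
  [ffun i => to_principal e (\sum_j X i j * from_principal (v j))].

Lemma principal_mx_linear : linear principal_mx.
Proof.
move=> a u v; apply/ffunP => i; apply: from_principal_inj.
rewrite !ffunE from_principal_linear !to_principalK -mulrA -mulrDr; congr (_ * _).
rewrite mulr_suml -big_split /=; apply: eq_bigr => j _.
by rewrite !ffunE from_principal_linear mulrDr mulrA.
Qed.

HB.instance Definition _ := GRing.isLinear.Build _ _ _ _ principal_mx
  principal_mx_linear.

End Matrices.

(** The hypotheses say that the map with matrix [Y] is a left inverse of the one with matrix [X],
    and that it kills the nonzero vector with entries [e * v i]. *)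
Lemma prec_copies_principal n e p (X Y : 'I_n -> 'I_n -> T) (v : 'I_n -> T) :
  p * p = p -> e * e = e ->
  (forall j j', p * (\sum_i Y j i * e * X i j') * p = p *+ (j == j')) ->
  (forall j, p * (\sum_i Y j i * e * v i) = 0) -> (exists i, e * v i != 0) ->
  prec (copies n (principal_right_module p)) (copies n (principal_right_module e)).
Proof.
move=> pp ee YX Yv [i0 vi0].
apply: (@prec_of_retraction _ _ _ (principal_mx e X (p := p)) (principal_mx p Y (p := e))
  [ffun i => to_principal e (v i)]).
- move=> w; apply/ffunP => j; apply: from_principal_inj.
  rewrite ffunE to_principalK.
  transitivity (\sum_j' p * (\sum_i Y j i * e * X i j') * p * from_principal (w j')).
    rewrite mulr_sumr.
    under eq_bigr do rewrite ffunE to_principalK !mulr_sumr.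
    rewrite exchange_big; apply: eq_bigr => j' _ /=.
    rewrite mulr_sumr !mulr_suml; apply: eq_bigr => i _.
    by rewrite -[in LHS](from_principalE (w j') pp) !mulrA.
  rewrite (bigD1 j) //= YX eqxx mulr1n from_principalE // big1 ?addr0 // => j' /negPf nj.
  by rewrite YX eq_sym nj mul0r.
- apply: contra_neq vi0 => /ffunP/(_ i0); rewrite !ffunE => /(congr1 (@from_principal e)).
  by rewrite to_principalK => ->.
- apply/ffunP => j; apply: from_principal_inj; rewrite !ffunE to_principalK.
  under eq_bigr do rewrite ffunE to_principalK mulrA.
  by rewrite Yv.
Qed.

(** An embedding of [p T] is left multiplication by the image [x] of the generator [p]; [y] is the
    preimage of the component of [e] in the summand. *)
Lemma prec_principal_dominates e p : p * p = p -> e * e = e ->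
  @prec T^c (principal_right_module p) (principal_right_module e) ->
  exists x y, y * x = p /\ e * x = x.
Proof.
move=> pp ee [M [[[Msub [N [Nsub MN MN0]]] _] [f [f_inj fM]]]].
have fE z : from_principal (f z) = from_principal (f (to_principal p 1)) * from_principal z.
  have {1}-> : z = (from_principal z : T^c) *: to_principal p 1.
    by apply: from_principal_inj; rewrite from_principalZ to_principalK mulr1 from_principalE.
  by rewrite linearZ.
set x := from_principal (f (to_principal p 1)) in fE.
have xM : f (to_principal p 1) \in M by apply/fM; exists (to_principal p 1).
have exx : e * x = x by exact: from_principalE.
have [a [b [aM bN ab]]] := MN (to_principal e 1).
have /fM[y fy] := aM.
exists x, (from_principal y); split=> //.
(* From [e = a + b] follows [x - a * x = b * x], which lies in both summands. *)
have ax : (x : T^c) *: a = f (to_principal p 1).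
  have dE : f (to_principal p 1) - (x : T^c) *: a = (x : T^c) *: b.
    apply/eqP; rewrite subr_eq addrC -scalerDr -ab; apply/eqP.
    by apply: from_principal_inj; rewrite from_principalZ to_principalK mulr1 exx.
  have [M0 Mlin] := Msub; have [N0 Nlin] := Nsub.
  apply/esym/eqP; rewrite -subr_eq0; apply/eqP; apply: MN0.
    by rewrite addrC -scaleNr; apply: Mlin.
  by rewrite dE -[_ *: b]addr0; apply: Nlin.
suff : to_principal p 1 = (x : T^c) *: y.
  by move/(congr1 (@from_principal p)); rewrite from_principalZ to_principalK mulr1.
by apply: f_inj; rewrite linearZ /= fy ax.
Qed.

End PrincipalModules.

(** * Actions by corner isomorphisms *)

Section CornerActionTheory.
Variables (A : pzRingType) (S : monoidType) (alpha : S -> {additive A -> A}).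
Hypothesis halpha : corner_action alpha.
Implicit Types (s t u : S) (a b e h x y z : A).

Local Notation p s := (alpha s 1).

Let alphaM s x y : alpha s (x * y) = alpha s x * alpha s y.
Proof. exact: (corner_action_mul halpha). Qed.

Lemma corner_unitM s t : p (s * t)%g = alpha s (p t).
Proof. exact: (corner_action_comp halpha). Qed.

Lemma corner_unitl s x : p s * alpha s x = alpha s x.
Proof. by rewrite -alphaM mul1r. Qed.

Lemma corner_unitr s x : alpha s x * p s = alpha s x.
Proof. by rewrite -alphaM mulr1. Qed.

Lemma corner_unit_idem s : p s * p s = p s.
Proof. exact: corner_unitl. Qed.

Lemma corner_surjective s x : p s * x * p s = x -> exists y, alpha s y = x.
Proof.
move=> xE; have : corner (p s) (p s) x by exists x.
by rewrite -(corner_action_image halpha) => -[y _]; exists y.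
Qed.

Lemma corner_action_eq0 s x : (alpha s x == 0) = (x == 0).
Proof.
apply/eqP/eqP => [x0|->]; last exact: raddf0.
by apply: (corner_action_inj halpha (s := s)); rewrite x0 raddf0.
Qed.

Lemma corner_unit_absorbl s t : p s * p (s * t)%g = p (s * t)%g.
Proof. by rewrite corner_unitM corner_unitl. Qed.

Lemma corner_unit_absorbr s t : p (s * t)%g * p s = p (s * t)%g.
Proof. by rewrite corner_unitM corner_unitr. Qed.

Lemma corner_unit_exp_absorbl u i j : (i <= j)%N ->
  p (u ^+ i)%g * p (u ^+ j)%g = p (u ^+ j)%g.
Proof. by move=> /subnKC <-; rewrite expgnDr corner_unit_absorbl. Qed.

Lemma corner_unit_exp_absorbr u i j : (i <= j)%N ->
  p (u ^+ j)%g * p (u ^+ i)%g = p (u ^+ j)%g.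
Proof. by move=> /subnKC <-; rewrite expgnDr corner_unit_absorbr. Qed.

Lemma corner_complementE u i :
  alpha (u ^+ i)%g (1 - p u) = p (u ^+ i)%g - p (u ^+ i.+1)%g.
Proof. by rewrite raddfB expgSr corner_unitM. Qed.

Lemma corner_complement_absorbed u i n : (i < n)%N ->
  alpha (u ^+ i)%g (1 - p u) * p (u ^+ n)%g = 0.
Proof.
move=> lt; rewrite corner_complementE mulrBl !corner_unit_exp_absorbl ?subrr//.
exact: ltnW.
Qed.

(** These are the successive differences of the decreasing chain of idempotents [p (u ^+ i)]. *)
Lemma corner_complement_orthogonal u i j : i != j ->
  alpha (u ^+ i)%g (1 - p u) * alpha (u ^+ j)%g (1 - p u) = 0.
Proof.
rewrite neq_ltn => /orP[] lt.
- rewrite [X in _ * X]corner_complementE mulrBr !corner_complement_absorbed ?subrr//.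
  exact: ltnW.
- rewrite [X in X * _]corner_complementE [X in _ * X]corner_complementE.
  have le := ltnW lt; have le1 := leqW le.
  by rewrite mulrBr !mulrBl !corner_unit_exp_absorbr ?subrr.
Qed.

(* With [q = 1 - p_u], the idempotents [alpha (u ^+ j) q], [j < N], are
   orthogonal and each dominates [p_(u ^+ N)] up to the same multiplicity [m] as [q]
   dominates [1]; so [N p_(u ^+ N) < m 1 <= m k e], where [1 <= k e].  The choice
   [N = m k] makes unperforation applicable. *)
Lemma corner_unit_subequivalent e u : simple_ring A -> strictly_unperforated A ->
  p u != 1 -> e * e = e -> e != 0 ->
  exists s x y, y * x = p s /\ e * x = x.
Proof.
move=> simA unpA pu ee e0; pose q := 1 - p u.
have q0 : q != 0 by rewrite subr_eq0 eq_sym.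
have [lq lq1] := simple_sum simA q0; have [le le1] := simple_sum simA e0.
pose L := [seq (r, c) | r <- lq, c <- le].
pose n := size L; pose P := p (u ^+ n)%g.
have PP : P * P = P by exact: corner_unit_idem.
exists (u ^+ n)%g; apply: prec_principal_dominates => //.
have qq : q * q = q.
  by rewrite /q mulrBl mul1r mulrBr mulr1 corner_unit_idem subrr subr0.
(* The default is never returned by [nth], as all indices are below [n = size L]. *)
pose d : (A * A) * (A * A) := ((0, 0), (0, 0)).
(* Each [i] stands for a pair of terms, one from each decomposition of [1]. In the product of [Y]
   and [X], summing over the second term contracts the factors around [e] to [1]; summing over the
   first then gives [p (u ^+ j)] on the diagonal, and orthogonality gives [0] off it. *)
pose X (i j : 'I_n) := let r := nth d L i in r.2.2 * alpha (u ^+ j)%g (q * r.1.2).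
pose Y (j i : 'I_n) := let r := nth d L i in alpha (u ^+ j)%g (r.1.1 * q) * r.2.1.
(* [Y] kills this vector because [alpha (u ^+ j) q * P = 0] for [j < n]. *)
pose v (i : 'I_n) := let r := nth d L i in r.2.2 * P.
have P0 : P != 0 by rewrite corner_action_eq0; case: simA.
have sumL (F : (A * A) * (A * A) -> A) : \sum_(i < n) F (nth d L i) = \sum_(r <- lq) \sum_(c <- le) F (r, c).
  by rewrite -[RHS]big_allpairs (big_nth d) big_mkord.
have [r0 r0lq] : exists r0, r0 \in lq.
  case: lq lq1 {L n P PP X Y v P0 sumL} => [|z lq _].
    by rewrite big_nil => /eqP; case: simA => /negPf->.
  by exists z; rewrite mem_head.
have [xy xyle exyP] : exists2 xy, xy \in le & e * (xy.2 * P) != 0.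
  apply: contrapT => nx; move/eqP: P0; apply.
  rewrite -[P]mul1r le1 mulr_suml big_seq big1 // => xy xyle.
  rewrite -!mulrA; have [->|ne] := eqVneq (e * (xy.2 * P)) 0; first by rewrite mulr0.
  by case: nx; exists xy.
have zxyL : (r0, xy) \in L by apply/allpairsP; exists (r0, xy).
apply: (unpA _ _ n (principal_right_finitely_generated PP)
  (principal_right_projective PP) (principal_right_finitely_generated ee)
  (principal_right_projective ee)).
  by rewrite lt0n size_eq0; apply: contraTneq zxyL => ->.
apply: (@prec_copies_principal _ _ _ _ X Y v) => //.
- move=> j j'.
  rewrite (sumL (fun r => alpha (u ^+ j)%g (r.1.1 * q) * r.2.1 * e *
    (r.2.2 * alpha (u ^+ j')%g (q * r.1.2)))) /=.
  under eq_bigr => w _.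
    under eq_bigr do rewrite -2!mulrA [e * _]mulrA [X in _ * X]mulrA.
    rewrite -mulr_sumr -mulr_suml.
    under eq_bigr do rewrite mulrA.
    rewrite -le1 mul1r !alphaM.
    over.
  have [jj'|njj'] := eqVneq j j'.
    rewrite -jj' mulr1n; transitivity (P * p (u ^+ j)%g * P); last first.
      by rewrite corner_unit_exp_absorbr // ltnW.
    congr (_ * _ * _).
    rewrite [in RHS]lq1 raddf_sum; apply: eq_bigr => w _ /=.
    by rewrite !alphaM !mulrA -(mulrA _ (alpha _ q) (alpha _ q)) -(alphaM _ q) qq.
  rewrite big1 ?mulr0 ?mul0r // => w _.
  rewrite !mulrA -(mulrA _ (alpha _ q) (alpha _ q)) corner_complement_orthogonal //.
  by rewrite mulr0 mul0r.
- move=> j; rewrite (sumL (fun r => alpha (u ^+ j)%g (r.1.1 * q) * r.2.1 * e * (r.2.2 * P))).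
  rewrite big1 ?mulr0 // => w _ /=.
  under eq_bigr do rewrite -2!mulrA [e * _]mulrA [X in _ * X]mulrA.
  rewrite -mulr_sumr -mulr_suml.
  under eq_bigr do rewrite mulrA.
  by rewrite -le1 mul1r alphaM -mulrA corner_complement_absorbed ?mulr0.
- have lt : (index (r0, xy) L < n)%N by rewrite index_mem.
  by exists (Ordinal lt); rewrite /v /= nth_index.
Qed.

(** By the intertwining relation, the [x] with [alpha t x] in [u A] form a nonzero two-sided ideal,
    which contains [1]: so [u] has a right inverse relative to [p t]. Symmetrically it has a left
    inverse relative to [p s]. *)
Lemma inner_of_intertwiner s t (u : A) : simple_ring A -> u != 0 ->
  p t * u = u -> u * p s = u ->
  (forall z, alpha t z * u = u * alpha s z) -> inner_pair alpha t s.
Proof.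
move=> simA u0 tu us uI; have [A1 simA'] := simA.
have [v uv] : exists v, u * v = p t.
  pose I : {pred A} := fun x => `[< exists a, alpha t x = u * a >].
  suff /asboolP[v vE] : 1 \in I by exists v.
  apply: simA'.
    apply: two_sided_idealI.
    - by apply/asboolP; exists 0; rewrite raddf0 mulr0.
    - move=> x y /asboolP[a xa] /asboolP[b yb]; apply/asboolP.
      by exists (a + b); rewrite raddfD xa yb mulrDr.
    - move=> z x /asboolP[a xa]; apply/asboolP.
      by exists (alpha s z * a); rewrite alphaM xa !mulrA uI.
    - move=> z x /asboolP[a xa]; apply/asboolP.
      by exists (a * alpha t z); rewrite alphaM xa !mulrA.
  have pt0 : p t != 0 by rewrite corner_action_eq0.
  have [a ua] := simple_prime simA u0 pt0.
  have [x xE] : exists x, alpha t x = u * a * p t.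
    by apply: corner_surjective; rewrite !mulrA tu -mulrA corner_unit_idem.
  exists x; last by rewrite -(corner_action_eq0 t) xE.
  by apply/asboolP; exists (a * p t); rewrite xE mulrA.
have [w wu] : exists w, w * u = p s.
  pose J : {pred A} := fun x => `[< exists a, alpha s x = a * u >].
  suff /asboolP[w wE] : 1 \in J by exists w.
  apply: simA'.
    apply: two_sided_idealI.
    - by apply/asboolP; exists 0; rewrite raddf0 mul0r.
    - move=> x y /asboolP[a xa] /asboolP[b yb]; apply/asboolP.
      by exists (a + b); rewrite raddfD xa yb mulrDl.
    - move=> z x /asboolP[a xa]; apply/asboolP.
      by exists (alpha s z * a); rewrite alphaM xa !mulrA.
    - move=> z x /asboolP[a xa]; apply/asboolP.
      by exists (a * alpha t z); rewrite alphaM xa -!mulrA uI.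
  have ps0 : p s != 0 by rewrite corner_action_eq0.
  have [a ua] := simple_prime simA ps0 u0.
  have [x xE] : exists x, alpha s x = p s * a * u.
    by apply: corner_surjective; rewrite !mulrA corner_unit_idem -mulrA us.
  exists x; last by rewrite -(corner_action_eq0 s) xE.
  by apply/asboolP; exists (p s * a).
(* Cut down to the corner, the left and right inverses of [u] coincide. *)
have wv : p s * w * p t = p s * v * p t.
  rewrite -[X in _ * _ * X = _]corner_unit_idem -[X in _ * _ * (X * _)]uv !mulrA.
  by rewrite -(mulrA _ w) wu corner_unit_idem.
exists u, (p s * v * p t); split.
- by exists u; rewrite tu us.
- by exists v.
- by rewrite !mulrA us uv corner_unit_idem.
- by rewrite -wv -mulrA tu -mulrA wu corner_unit_idem.
- by move=> z; rewrite -uI !mulrA -(mulrA _ u) us -(mulrA _ u) uv !corner_unitr.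
Qed.

(** By simplicity [1] is a sum of terms [r.1 * h * r.2], and summing [alpha t r.1 * a * alpha s r.2]
    spreads the intertwiner from [h A h] to all of [A]; compressing by [h] gives back [a], so the
    sum is nonzero. *)
Lemma inner_of_corner_intertwiner s t h a : simple_ring A ->
  h * h = h -> h != 0 -> a != 0 -> alpha t h * a = a -> a * alpha s h = a ->
  (forall x, h * x * h = x -> alpha t x * a = a * alpha s x) ->
  inner_pair alpha t s.
Proof.
move=> simA hh h0 a0 ta as_ aI; have [l l1] := simple_sum simA h0.
have aIh x : alpha t (h * x * h) * a = a * alpha s (h * x * h).
  by apply: aI; rewrite !mulrA hh -!mulrA hh.
pose u := \sum_(r <- l) alpha t r.1 * a * alpha s r.2.
have uh : alpha t h * u * alpha s h = a.
  rewrite mulr_sumr mulr_suml.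
  transitivity (\sum_(r <- l) a * alpha s (h * (r.1 * h * r.2) * h)).
    apply: eq_bigr => r _.
    rewrite -[in LHS]ta !mulrA -!alphaM aIh -!mulrA -!alphaM; congr (_ * alpha s _).
    by rewrite !mulrA.
  by rewrite -mulr_sumr -raddf_sum -mulr_suml -mulr_sumr -l1 mulr1 hh.
apply: (inner_of_intertwiner simA (u := u)).
- by apply: contra_neq a0 => u0; rewrite -uh u0 mulr0 mul0r.
- by rewrite mulr_sumr; apply: eq_bigr => r _; rewrite !mulrA corner_unitl.
- by rewrite mulr_suml; apply: eq_bigr => r _; rewrite -!mulrA corner_unitr.
move=> z.
(* A second copy of the decomposition, inserted before [z], encloses [r'.2 * z * r.1] between two
   factors [h], so that it can cross [a]; the sum over [r] then collapses to [1]. *)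
transitivity (\sum_(r <- l) \sum_(r' <- l)
    alpha t r'.1 * (a * alpha s (h * (r'.2 * z * r.1) * h)) * alpha s r.2).
  rewrite mulr_sumr; apply: eq_bigr => r _.
  rewrite -[in LHS]ta !mulrA -!alphaM -[z in LHS]mul1r {1}l1 !mulr_suml raddf_sum !mulr_suml.
  apply: eq_bigr => r' _; rewrite -aIh !mulrA -!alphaM; congr (alpha t _ * _ * _).
  by rewrite !mulrA.
rewrite exchange_big mulr_suml; apply: eq_bigr => r' _ /=.
transitivity (\sum_(r <- l) alpha t r'.1 * a * alpha s (h * r'.2 * z) * alpha s (r.1 * h * r.2)).
  by apply: eq_bigr => r _; rewrite !mulrA -!(mulrA (_ * a)) -!alphaM !mulrA.
rewrite -mulr_sumr -raddf_sum -l1 -!mulrA -!alphaM -[in RHS]as_ -!mulrA -!alphaM mulr1.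
by rewrite !mulrA.
Qed.

(* Otherwise [b a1 alpha_t(c) |-> b a0 alpha_s(c)] is well defined.  Reducing to the
   case [a1 = alpha_t(h)] with [h] idempotent, evaluating this map at idempotents
   shows that [a0] intertwines [alpha_t] and [alpha_s] on the idempotents of [h A h],
   hence on all of [h A h]. *)
Lemma outer_separation u s t a0 a1 : simple_ring A -> strictly_unperforated A ->
  right_ideals_have_idempotents A -> outer_action alpha -> p u != 1 ->
  s != t -> a0 != 0 -> a0 * p s = a0 -> a1 * p t = a1 ->
  exists b c, b * a1 * alpha t c = 0 /\ b * a0 * alpha s c != 0.
Proof.
move=> simA unpA idA outA pu sNt a00 a0s a1t; apply: contrapT => nex.
have H b c : b * a1 * alpha t c = 0 -> b * a0 * alpha s c = 0.
  move=> bc; have [//|ne] := eqVneq (b * a0 * alpha s c) 0.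
  by case: nex; exists b, c.
have H1 b : b * a1 = 0 -> b * a0 = 0.
  by move=> ba1; rewrite -a0s mulrA H // ba1 mul0r.
have [y [gg ya0]] := idempotent_left_multiple_separating simA idA H1 a00.
have gt : y * a1 * p t = y * a1 by rewrite -mulrA a1t.
(* The idempotent [y * a1] absorbs [p t] on the right; cutting by [p t] on the left moves it into
   the corner that is the image of [alpha t]. *)
have [h hE] : exists h, alpha t h = p t * (y * a1).
  by apply: corner_surjective; rewrite !mulrA corner_unit_idem -!mulrA a1t.
pose a := p t * y * a0.
have ga : y * a1 * a = y * a0.
  have : (1 - y * a1) * y * a1 = 0 by rewrite -mulrA mulrBl gg mul1r subrr.
  move/H1; rewrite mulrBl mul1r mulrBl => /eqP; rewrite subr_eq0 => /eqP ->.
  by rewrite /a !mulrA gt.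
have a_neq0 : a != 0 by apply: contra_neq ya0 => a0E; rewrite -ga a0E mulr0.
have as1 : a * p s = a by rewrite /a -mulrA a0s.
have Ha b c : b * alpha t (h * c) = 0 -> b * a * alpha s c = 0.
  by rewrite alphaM hE /a !mulrA => /H.
have hh : h * h = h.
  apply: (corner_action_inj halpha (s := t)); rewrite alphaM hE.
  by rewrite mulrA -(mulrA (p t)) gt -mulrA gg.
have ta : alpha t h * a = a.
  have := Ha (1 - alpha t h) 1; rewrite mulr1 -mulrA as1 !mulrBl !mul1r -alphaM hh.
  by rewrite subrr => /(_ erefl)/eqP; rewrite subr_eq0 => /eqP.
have as_ : a * alpha s h = a.
  have := Ha 1 (1 - h); rewrite !mul1r mulrBr mulr1 hh subrr raddf0.
  by rewrite raddfB mulrBr as1 => /(_ erefl)/eqP; rewrite subr_eq0 => /eqP.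
clearbody a.
have h0 : h != 0.
  by apply: contra_neq a_neq0 => h0; rewrite -ta h0 raddf0 mul0r.
suff aI x : h * x * h = x -> alpha t x * a = a * alpha s x.
  apply: (outA t s); first by rewrite eq_sym.
  exact: (inner_of_corner_intertwiner simA hh h0 a_neq0 ta as_).
have [r [x' [y' [yx hx]]]] := corner_unit_subequivalent simA unpA pu hh h0.
(* [k] is the copy below [h] of [alpha r (p u)], which is neither [0] nor [p r]: it is a nonzero
   idempotent of [h A h] other than [h]. *)
pose k := x' * alpha r (p u) * (y' * h).
have yx1 : y' * h * x' = p r by rewrite -mulrA hx.
have ykx : (y' * h) * k * x' = alpha r (p u).
  by rewrite /k !mulrA yx1 -!mulrA [y' * _]mulrA yx1 corner_unitr corner_unitl.
move: x; apply: (corner_generated_by_idempotents simA hh (k := k)).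
- have -> : k * k = x' * alpha r (p u) * (y' * h * x') * alpha r (p u) * (y' * h).
    by rewrite /k !mulrA.
  by rewrite yx1 -(mulrA x') corner_unitr -(mulrA x') -alphaM corner_unit_idem.
- by rewrite /k !mulrA hx.
- by rewrite /k -!mulrA hh.
- apply: contra_neq (_ : alpha r (p u) != 0); last first.
    by rewrite !corner_action_eq0; case: simA.
  by move=> k0; rewrite -ykx k0 mulr0 mul0r.
- apply: contra_neq pu => kh; apply: (corner_action_inj halpha (s := r)).
  by rewrite -ykx kh -(mulrA y') hh yx1.
(* Both [alpha t c * a] and [a * alpha s c] equal [alpha t c * a * alpha s c]. *)
- move=> c cc hc ch.
  have E1 : alpha t c * a * alpha s c = a * alpha s c.
    have := Ha (1 - alpha t c) c; rewrite hc mulrBl mul1r -alphaM cc subrr.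
    by move/(_ erefl)/eqP; rewrite !mulrBl mul1r subr_eq0 => /eqP.
  rewrite -E1; have := Ha (alpha t c) (h - c).
  rewrite mulrBr hh hc -alphaM mulrBr ch cc subrr raddf0 => /(_ erefl)/eqP.
  by rewrite raddfB mulrBr -mulrA as_ subr_eq0 => /eqP.
- by move=> x y1 Ex Ey; rewrite !raddfB mulrBl mulrBr Ex Ey.
- by move=> x y1 Ex Ey; rewrite !alphaM -mulrA Ey !mulrA Ex.
Qed.

(** The terms are killed one at a time: each separation multiplies the products that already vanish
    by further factors, so they stay zero. *)
Lemma outer_elimination u s a (l : seq (S * A)) : simple_ring A ->
  strictly_unperforated A -> right_ideals_have_idempotents A ->
  outer_action alpha -> p u != 1 -> a != 0 -> a * p s = a ->
  {in l, forall r, r.1 != s} ->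
  exists b c, b * a * alpha s c != 0 /\
    {in l, forall r, b * r.2 * alpha r.1 c = 0}.
Proof.
move=> simA unpA idA outA pu a0 as_; elim: l => [|[t a1] l IHl] lNs.
  by exists 1, 1; rewrite mul1r as_.
have [|b [c [nz z]]] := IHl; first by move=> r rl; apply: lNs; rewrite inE rl orbT.
have sNt : s != t by rewrite eq_sym; apply: (lNs (t, a1)); rewrite mem_head.
have [||b' [c' [z' nz']]] := outer_separation (a1 := b * a1 * alpha t c)
    simA unpA idA outA pu sNt nz.
- by rewrite -mulrA corner_unitr.
- by rewrite -mulrA corner_unitr.
exists (b' * b), (c * c'); split; first by rewrite alphaM !mulrA in nz' *.
move=> r; rewrite inE => /predU1P[->|rl] /=; first by rewrite alphaM !mulrA in z' *.
by rewrite alphaM mulrA -2!(mulrA b') [b * _ * _]z // mulr0 mul0r.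
Qed.

End CornerActionTheory.

(** * Normal forms in the skew monoid ring *)
Section SubringSig.
Variables (R : pzRingType) (I : subringClosed R).

(** The subring as a ring in its own right, so that it can be a target of the universal property. *)
Definition subring_sig := {x : R | x \in I}.

HB.instance Definition _ := SubChoice.on subring_sig.

HB.instance Definition _ := GRing.SubChoice_isSubPzRing.Build R _ subring_sig
  (subringClosedP _).

End SubringSig.

Section SkewMonoidRing.
Variables (A : pzRingType) (S : monoidType) (alpha : S -> {additive A -> A}).
Variables (R : pzRingType) (phi : {rmorphism A -> R}) (minus plus : S -> R).
Implicit Types (s t u : S) (a b : A) (x y z : R).

(** The universal map from [R] to the subring, followed by the inclusion, fixes the generators, so
    by uniqueness it is the identity. *)
Lemma skew_monoid_ring_generated (I : {pred R}) :
  is_skew_monoid_ring alpha phi minus plus -> subring_closed I ->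
  (forall a, phi a \in I) -> (forall s, minus s \in I) ->
  (forall t, plus t \in I) -> forall x, x \in I.
Proof.
move=> [rel univ] Isub Iphi Iminus Iplus x.
pose mixI := GRing.isSubringClosed.Build R I Isub.
pose J : subringClosed R := HB.pack I mixI.
pose R' := subring_sig J.
pose phi' a : R' := exist _ (phi a) (Iphi a).
pose minus' s : R' := exist _ (minus s) (Iminus s).
pose plus' s : R' := exist _ (plus s) (Iplus s).
have phiB : zmod_morphism phi' by move=> a b; apply: val_inj; rewrite /= raddfB.
have phiM : monoid_morphism phi'.
  by split=> [|a b]; apply: val_inj; rewrite /= ?rmorph1 ?rmorphM.
pose phi'' : {rmorphism A -> R'} := HB.pack phi'
  (GRing.isZmodMorphism.Build _ _ _ phiB) (GRing.isMonoidMorphism.Build _ _ _ phiM).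
have rel' : skew_relations alpha phi'' minus' plus'.
  case: rel => *; split=> *; apply: val_inj => //=.
have [f [[fphi fminus fplus] _]] := univ _ _ _ _ rel'.
have [g [_ guniq]] := univ _ _ _ _ rel.
pose id' : {rmorphism R -> R} := idfun.
pose fv : {rmorphism R -> R} := \val \o f.
have -> : x = \val (f x).
  rewrite -[LHS]/(id' x) guniq; last by split.
  rewrite -[RHS]/(fv x) guniq //.
  by split=> c; rewrite /= ?fphi ?fminus ?fplus.
exact: valP.
Qed.

Hypothesis rel : skew_relations alpha phi minus plus.
Hypothesis halpha : corner_action alpha.
Hypothesis ore : forall s t, exists x y : S, (x * s = y * t)%g.

Definition skew_monomial x := exists s a t, x = minus s * phi a * plus t.

(** Given [v * t = w * s'], inserting [minus v * plus v = 1] before the inner factor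
    [plus t * minus s'] brings it to the form [minus v * phi _ * plus w]. *)
Lemma skew_monomialM x y : skew_monomial x -> skew_monomial y ->
  skew_monomial (x * y).
Proof.
move=> [s [a [t ->]]] [s' [b [t' ->]]]; have [v [w vw]] := ore t s'.
exists (v * s)%g, (alpha v a * alpha w (alpha s' 1 * b)), (w * t')%g.
have tE : plus t * minus s' = minus v * phi (alpha w (alpha s' 1)) * plus w.
  rewrite -[LHS]mul1r -(skew_minus_plus rel v) -!mulrA; congr (_ * _).
  rewrite mulrA -(skew_plusM rel) vw (skew_plusM rel) -mulrA (skew_plus_minus rel).
  exact: (skew_plusE rel).
rewrite (skew_minusM rel) (skew_plusM rel) (corner_action_mul halpha) !rmorphM.
transitivity (minus s * phi a * (plus t * minus s') * phi b * plus t').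
  by rewrite !mulrA.
rewrite tE !mulrA -(mulrA _ (phi a)) (skew_minusE rel) !mulrA.
by rewrite -(mulrA _ (plus w)) (skew_plusE rel) !mulrA.
Qed.

Definition skew_span : {pred R} := fun x =>
  `[< exists2 l : seq R, (forall m, m \in l -> skew_monomial m) & x = \sum_(m <- l) m >].

Lemma skew_monomial_span x : skew_monomial x -> x \in skew_span.
Proof.
move=> xm; apply/asboolP; exists [:: x]; last by rewrite big_seq1.
by move=> m; rewrite inE => /eqP->.
Qed.

Lemma skew_monomialN x : skew_monomial x -> skew_monomial (- x).
Proof.
by move=> [s [a [t ->]]]; exists s, (- a), t; rewrite rmorphN mulrN mulNr.
Qed.

Lemma skew_monomial_coef a : skew_monomial (phi a).
Proof.
by exists 1%g, a, 1%g; rewrite (skew_minus1 rel) (skew_plus1 rel) mul1r mulr1.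
Qed.

Lemma skew_span_subring : subring_closed skew_span.
Proof.
split.
- by rewrite -(rmorph1 phi); apply/skew_monomial_span/skew_monomial_coef.
- move=> _ _ /asboolP[l lm ->] /asboolP[l' lm' ->]; apply/asboolP.
  exists (l ++ [seq - m | m <- l']); last by rewrite big_cat big_map sumrN.
  move=> m; rewrite mem_cat => /orP[/lm//|/mapP[m' /lm' mm' ->]].
  exact: skew_monomialN.
- move=> _ _ /asboolP[l lm ->] /asboolP[l' lm' ->]; apply/asboolP.
  exists [seq m * m' | m <- l, m' <- l'].
    by move=> _ /allpairsP[[m m'] [/= /lm ml /lm' ml' ->]]; apply: skew_monomialM.
  by rewrite big_allpairs_dep mulr_suml; apply: eq_bigr => m _; rewrite mulr_sumr.
Qed.

(** Degrees may repeat in [l]; equal ones are collected in [skew_polynomial_leading]. *)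
Definition skew_polynomial (l : seq (S * A)) : R :=
  \sum_(r <- l) phi r.2 * plus r.1.

(** Induction on the number of monomials: a common left multiple [v * s = w * s'] clears the
    denominator [s] found so far together with the new one [s']. *)
Lemma skew_common_denominator x : is_skew_monoid_ring alpha phi minus plus ->
  exists s l, plus s * x = skew_polynomial l.
Proof.
move=> hR; have : x \in skew_span.
  apply: (skew_monoid_ring_generated hR skew_span_subring) => [a|s|t];
    apply: skew_monomial_span; first exact: skew_monomial_coef.
  - by exists s, 1, 1%g; rewrite (skew_plus1 rel) rmorph1 !mulr1.
  - by exists 1%g, 1, t; rewrite (skew_minus1 rel) rmorph1 !mul1r.
have plusP s l : exists l', plus s * skew_polynomial l = skew_polynomial l'.
  exists [seq ((s * r.1)%g, alpha s r.2) | r <- l].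
  rewrite /skew_polynomial big_map mulr_sumr; apply: eq_bigr => r _ /=.
  by rewrite (skew_plusM rel) !mulrA (skew_plusE rel).
case/asboolP => l lm ->; elim: l lm => [|m l IHl] lm.
  by exists 1%g, [::]; rewrite /skew_polynomial !big_nil mulr0.
have [|s [l' sl']] := IHl; first by move=> m' ml; apply: lm; rewrite inE ml orbT.
have [s' [a [t mE]]] := lm m (mem_head _ _).
have [v [w vw]] := ore s s'.
have [l2 l2E] := plusP v l'.
exists (v * s)%g, (((w * t)%g, alpha w (alpha s' 1 * a)) :: l2).
rewrite big_cons mulrDr /skew_polynomial big_cons -/(skew_polynomial l2) /=.
rewrite -l2E -sl' mulrA -(skew_plusM rel) vw; congr (_ + _).
rewrite mE (skew_plusM rel) (skew_plusM rel) !mulrA -(mulrA (plus w)).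
by rewrite (skew_plus_minus rel) -(mulrA (plus w)) -rmorphM (skew_plusE rel).
Qed.

(** Collect the terms having the degree [s] of the first one. Since
    [plus s = phi (alpha s 1) * plus s], a collected coefficient killed by [alpha s 1] contributes
    [0], and a shorter list remains. *)
Lemma skew_polynomial_leading l : skew_polynomial l != 0 ->
  exists s a l', [/\ a * alpha s 1 != 0, {in l', forall r, r.1 != s} &
    skew_polynomial l = phi a * plus s + skew_polynomial l'].
Proof.
have [n] := ubnP (size l); elim: n l => // n IHn [|[s a] l] /=.
  by rewrite /skew_polynomial big_nil eqxx.
rewrite ltnS => ln l0.
pose l1 := [seq r <- (s, a) :: l | r.1 != s].
pose b := \sum_(r <- (s, a) :: l | r.1 == s) r.2.
have lE : skew_polynomial ((s, a) :: l) = phi b * plus s + skew_polynomial l1.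
  rewrite /skew_polynomial (bigID (fun r => r.1 == s)) /= big_filter; congr (_ + _).
  rewrite raddf_sum mulr_suml; apply: eq_bigr => r /eqP-> //.
have [b0|b0] := eqVneq (b * alpha s 1) 0; last first.
  by exists s, b, l1; split=> // r; rewrite mem_filter => /andP[].
have bs : phi b * plus s = 0.
  by rewrite -[plus s]mulr1 -(rmorph1 phi) (skew_plusE rel) mulrA -rmorphM b0 rmorph0 mul0r.
rewrite lE bs add0r in l0 *; apply: IHn => //.
by rewrite /l1 /= eqxx /=; apply: leq_ltn_trans ln; rewrite size_filter count_size.
Qed.

End SkewMonoidRing.

(** * A nonzero representation *)

Section AdditiveEndomorphisms.
Variable M : zmodType.

(** As a predicate on functions, it lets endomorphisms inherit pointwise addition; composition will
    be the product. *)
Definition is_endo : {pred M -> M} := fun f => `[< zmod_morphism f >].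

Lemma is_endoP f : reflect (zmod_morphism f) (f \in is_endo).
Proof. exact: asboolP. Qed.

Lemma is_endo_zmod_closed : zmod_closed is_endo.
Proof.
split; first by apply/is_endoP => x y; rewrite subr0.
move=> f g /is_endoP fB /is_endoP gB; apply/is_endoP => x y.
rewrite -[LHS]/(f (x - y) - g (x - y)) -[RHS]/((f x - g x) - (f y - g y)) fB gB.
by rewrite !opprD !opprK addrACA.
Qed.

HB.instance Definition _ := GRing.isZmodClosed.Build (M -> M) is_endo
  is_endo_zmod_closed.

Definition endo := {f : M -> M | f \in is_endo}.

HB.instance Definition _ := SubChoice.on endo.
HB.instance Definition _ := [SubChoice_isSubZmodule of endo by <:].

Lemma endoB (f : endo) : zmod_morphism (val f).
Proof. exact/is_endoP/(valP f). Qed.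

Lemma endo_eq (f g : endo) : val f =1 val g -> f = g.
Proof. by move=> fg; apply/val_inj/funext. Qed.

Lemma endo_comp_subproof (f g : endo) : val f \o val g \in is_endo.
Proof. by apply/is_endoP => x y /=; rewrite !endoB. Qed.

Lemma endo_id_subproof : id \in is_endo.
Proof. by apply/is_endoP. Qed.

Definition endo_comp (f g : endo) : endo := exist _ (val f \o val g) (endo_comp_subproof f g).
Definition endo_id : endo := exist _ id endo_id_subproof.

Lemma endo_compA : associative endo_comp.
Proof. by move=> f g h; apply: endo_eq. Qed.

Lemma endo_comp1l : left_id endo_id endo_comp.
Proof. by move=> f; apply: endo_eq. Qed.

Lemma endo_comp1r : right_id endo_id endo_comp.
Proof. by move=> f; apply: endo_eq. Qed.

Lemma endo_compDl : left_distributive endo_comp +%R.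
Proof. by move=> f g h; apply: endo_eq. Qed.

Lemma endo_compDr : right_distributive endo_comp +%R.
Proof.
move=> f g h; apply: endo_eq => x.
have fN y : val f (- y) = - val f y.
  by rewrite -sub0r endoB -[0 in LHS](subrr 0) endoB subrr sub0r.
rewrite -[LHS]/(val f (val g x + val h x)) -[RHS]/(val f (val g x) + val f (val h x)).
by rewrite -[X in _ (_ + X) = _]opprK endoB fN opprK.
Qed.

HB.instance Definition _ := GRing.Zmodule_isPzRing.Build endo
  endo_compA endo_comp1l endo_comp1r endo_compDl endo_compDr.

End AdditiveEndomorphisms.

(** * Endomorphisms induced on quotient groups *)

Section QuotientEndomorphisms.
Local Open Scope quotient_scope.
Variables (V : zmodType) (N : zmodClosed V).
Local Notation Q := (Quotient.quot N).

Lemma quot_eqP (x y : V) : x - y \in N -> \pi_Q x = \pi_Q y.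
Proof. by rewrite Quotient.idealrBE => /eqP. Qed.

Lemma quot_endo_eq (f g : endo Q) :
  (forall x, val f (\pi_Q x) = val g (\pi_Q x)) -> f = g.
Proof. by move=> fg; apply: endo_eq => z; rewrite -[z]reprK fg. Qed.

Variables (T : V -> V) (TB : zmod_morphism T).
Hypothesis TN : forall x, x \in N -> T x \in N.

Lemma quot_mapE x : \pi_Q (T (repr (\pi_Q x))) = \pi_Q (T x).
Proof. by apply: quot_eqP; rewrite -TB; apply: TN; rewrite Quotient.idealrBE reprK. Qed.

Lemma quot_map_endo : (fun z : Q => \pi_Q (T (repr z))) \in is_endo (M := Q).
Proof.
apply/is_endoP => x y; rewrite -[x]reprK -[y]reprK -raddfB !quot_mapE.
by rewrite TB raddfB.
Qed.

Definition quot_endo : endo Q := exist _ (fun z : Q => \pi_Q (T (repr z))) quot_map_endo.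

Lemma quot_endoE x : val quot_endo (\pi_Q x) = \pi_Q (T x).
Proof. exact: quot_mapE. Qed.

End QuotientEndomorphisms.

Lemma quot_endo_compE (V : zmodType) (N : zmodClosed V) (T T' : V -> V)
    (TB : zmod_morphism T) (TN : forall x, x \in N -> T x \in N)
    (TB' : zmod_morphism T') (TN' : forall x, x \in N -> T' x \in N) x :
  val (quot_endo TB TN * quot_endo TB' TN') (\pi_(Quotient.quot N) x)%qT =
  (\pi_(Quotient.quot N) (T (T' x)))%qT.
Proof. by rewrite -(quot_endoE TB TN) -(quot_endoE TB' TN'). Qed.

(* The coefficient of [plus x * r], [r] in [R], at a fixed degree is a function of
   [x] determined by its values on a cofinal left ideal [S s0] of [S].  The group [G]
   is used as index set only so that [minus s] acts by a translation. *)
Section GermModel.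
Variables (A : pzRingType) (G : groupType) (inS : pred G) (S : subMonoidType inS).
Hypothesis ore : forall s t : S, exists x y : S, (x * s = y * t)%g.
Variable alpha : S -> {additive A -> A}.
Hypothesis halpha : corner_action alpha.
Implicit Types (s t : S) (g : G) (a : A) (f : G -> A).

Local Notation p s := (alpha s 1).

(** A value [f x] counts only through [p x * f x], for [x] in some [S s]; the Ore condition makes
    these left ideals directed, so null functions form a subgroup. *)
Definition germ_null : {pred G -> A} := fun f =>
  `[< exists s, forall y : S, p (y * s)%g * f (val (y * s)%g) = 0 >].

Lemma germ_null_zmod_closed : zmod_closed germ_null.
Proof.
split; first by apply/asboolP; exists 1%g => y; rewrite mulr0.
move=> f f' /asboolP[s sf] /asboolP[t tf]; apply/asboolP.
have [x [y xy]] := ore s t; exists (x * s)%g => z; rewrite mulrBr.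
by rewrite mulgA sf -mulgA xy mulgA tf subrr.
Qed.

HB.instance Definition _ := GRing.isZmodClosed.Build (G -> A) germ_null
  germ_null_zmod_closed.

Local Notation germ := (Quotient.quot germ_null).
Local Open Scope quotient_scope.

Lemma germ_eq s f f' :
  (forall y : S, p (y * s)%g * f (val (y * s)%g) = p (y * s)%g * f' (val (y * s)%g)) ->
  \pi_germ f = \pi_germ f'.
Proof.
move=> ff'; apply: quot_eqP; apply/asboolP; exists s => y.
by rewrite mulrBr ff' subrr.
Qed.

(** Outside [S] the index defaults to [1]; germs look at points of [S] alone. *)
Definition action_at g : {additive A -> A} := alpha (insubd 1%g g).

Lemma action_at_val s : action_at (val s) = alpha s.
Proof. by rewrite /action_at valKd. Qed.

(** These three operators mimic [plus x * phi a = phi (alpha x a) * plus x],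
    [plus x * plus t = plus (x * t)] and, for [x = y * s], [plus x * minus s = phi (p x) * plus y].
    The factor [p (g * t)] in [germ_plus] makes it preserve null functions. *)
Definition germ_scale a f g := action_at g a * f g.
Definition germ_plus t f g := action_at (g * val t)%g 1 * f (g * val t)%g.
Definition germ_minus s f g := f (g * (val s)^-1)%g.

Lemma germ_scaleB a : zmod_morphism (germ_scale a).
Proof. by move=> f f'; apply: funext => g; rewrite /germ_scale mulrBr. Qed.

Lemma germ_plusB t : zmod_morphism (germ_plus t).
Proof. by move=> f f'; apply: funext => g; rewrite /germ_plus mulrBr. Qed.

Lemma germ_minusB s : zmod_morphism (germ_minus s).
Proof. by []. Qed.

Lemma germ_scale_null a f : f \in germ_null -> germ_scale a f \in germ_null.
Proof.
move=> /asboolP[s sf]; apply/asboolP; exists s => y.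
rewrite /germ_scale action_at_val mulrA (corner_unitl halpha).
by rewrite -(corner_unitr halpha) -mulrA sf mulr0.
Qed.

Lemma germ_plus_null t f : f \in germ_null -> germ_plus t f \in germ_null.
Proof.
move=> /asboolP[s sf]; apply/asboolP; have [x [y xy]] := ore t s.
exists x => z; rewrite /germ_plus -gmulfM /= action_at_val.
by rewrite -(mulgA z) xy mulgA sf mulr0.
Qed.

Lemma germ_minus_null s f : f \in germ_null -> germ_minus s f \in germ_null.
Proof.
move=> /asboolP[t tf]; apply/asboolP; exists (t * s)%g => y.
rewrite /germ_minus mulgA gmulfM /= mulgK (corner_unitM halpha).
by rewrite -(corner_unitr halpha) -mulrA tf mulr0.
Qed.

Definition germ_phi a := quot_endo (germ_scaleB a) (@germ_scale_null a).
Definition germ_plus_endo t := quot_endo (germ_plusB t) (@germ_plus_null t).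
Definition germ_minus_endo s := quot_endo (@germ_minusB s) (@germ_minus_null s).

Lemma germ_phiB : zmod_morphism germ_phi.
Proof.
move=> a b; apply: quot_endo_eq => f; rewrite quot_endoE.
rewrite -[RHS]/(val (germ_phi a) _ - val (germ_phi b) _) !quot_endoE -raddfB.
by congr \pi; apply: funext => g; rewrite /germ_scale raddfB mulrBl.
Qed.

Lemma germ_phiM : monoid_morphism germ_phi.
Proof.
split=> [|a b]; apply: quot_endo_eq => f; rewrite quot_endoE.
  by apply: (@germ_eq 1%g) => y; rewrite /germ_scale action_at_val mulrA corner_unit_idem.
rewrite quot_endo_compE.
congr \pi; apply: funext => g.
by rewrite /germ_scale (corner_action_mul halpha) mulrA.
Qed.

HB.instance Definition _ := GRing.isZmodMorphism.Build A (endo germ) germ_phi germ_phiB.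
HB.instance Definition _ := GRing.isMonoidMorphism.Build A (endo germ) germ_phi germ_phiM.

Lemma germ_skew_relations :
  skew_relations alpha (germ_phi : {rmorphism A -> endo germ})
    germ_minus_endo germ_plus_endo.
Proof.
split=> [|s t||s t|t a|s a|s|s]; apply: quot_endo_eq => f; rewrite ?quot_endo_compE ?quot_endoE.
- congr \pi; apply: funext => g.
  by rewrite /germ_minus gmulf1 invg1 mulg1.
- congr \pi; apply: funext => g.
  by rewrite /germ_minus gmulfM invgM mulgA.
- apply: (@germ_eq 1%g) => y.
  by rewrite /germ_plus gmulf1 /= !mulg1 action_at_val mulrA corner_unit_idem.
- apply: (@germ_eq 1%g) => y; congr (_ * _); move: (y * 1)%g => x.
  rewrite /germ_plus gmulfM /= mulgA -!gmulfM /= !action_at_val.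
  by rewrite mulrA corner_unit_absorbl.
- apply: (@germ_eq 1%g) => y; congr (_ * _); move: (y * 1)%g => x.
  rewrite /germ_plus /germ_scale -!gmulfM /= !action_at_val.
  by rewrite !mulrA corner_unitl // -(corner_action_comp halpha) corner_unitr.
(* At a point [x] of [S s] the translate of [x] by the inverse of [s] is again in [S], and [alpha x]
   factors through [alpha s]. *)
- apply: (@germ_eq s) => y.
  rewrite /germ_minus /germ_scale action_at_val gmulfM /= mulgK action_at_val.
  by rewrite !(corner_action_comp halpha).
- rewrite -[RHS]/(\pi_germ f); apply: (@germ_eq 1%g) => y.
  by rewrite /germ_plus /germ_minus mulgVK action_at_val mulrA corner_unit_idem.
- apply: (@germ_eq 1%g) => y; congr (_ * _); move: (y * 1)%g => x.
  rewrite /germ_plus /germ_minus /germ_scale mulgK -gmulfM /= !action_at_val.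
  by rewrite corner_unitM.
Qed.

Lemma germ_one_neq0 : (1 : A) != 0 -> (1 : endo germ) != 0.
Proof.
move=> A1; apply/eqP => E.
have := congr1 (fun x : endo germ => val x (\pi_germ (fun=> 1))) E.
rewrite /= -[RHS](raddf0 \pi_germ) => /eqP; rewrite -Quotient.idealrBE.
move=> /asboolP[s /(_ 1%g)]; rewrite fctE subr0 mulr1 => /eqP.
by rewrite (corner_action_eq0 halpha) (negPf A1).
Qed.

End GermModel.

(** * Pure infiniteness *)

Section PurelyInfinite.
Variable T : pzRingType.

Definition principal_mul (e p c : T) (z : principal_right_module p) :
    principal_right_module e :=
  to_principal e (c * from_principal z).

Lemma principal_mul_linear e p c : linear (@principal_mul e p c).
Proof.
move=> a u v; apply: from_principal_inj.
by rewrite /principal_mul !(from_principal_linear, to_principalK) !mulrDr !mulrA.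
Qed.

HB.instance Definition _ e p c := GRing.isLinear.Build _ _ _ _
  (@principal_mul e p c) (@principal_mul_linear e p c).

(** If [x * r * y = 1], then [a |-> r * y * a * x] is an injective multiplicative map sending [1] to
    an idempotent [e] of [r T]; it carries the one-sided inverses [v] and [w] into [e T e], where
    they embed [e T] as a proper summand of itself. *)
Lemma purely_infinite_of_units (v w : T) : (1 : T) != 0 ->
  (forall r : T, r != 0 -> exists x y, x * r * y = 1) ->
  w * v = 1 -> v * w != 1 -> purely_infinite_simple T.
Proof.
move=> T1 inv wv vw; split; first split=> // I [[I0 Il] [_ Ir]] [r rI /inv[x [y xry]]] z.
  have rIl a b : b \in I -> a * b \in I.
    by move=> bI; rewrite -[a * b]addr0; apply: (Il a).
  have rIr a b : b \in I -> b * a \in I.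
    by move=> bI; rewrite -[b * a]addr0; apply: (Ir a).
  by rewrite -[z]mulr1 -xry; apply/rIl/rIr/rIl.
move=> I [I0 Ir] [r rI /inv[x [y xry]]].
pose conj a := r * y * a * x.
have conjM a b : conj a * conj b = conj (a * b).
  have -> : conj a * conj b = r * y * a * (x * r * y) * b * x by rewrite /conj !mulrA.
  by rewrite xry mulr1 /conj !mulrA.
have conj_inj a b : conj a = conj b -> a = b.
  move=> ab; have := congr1 (fun z => x * z * (r * y)) ab; rewrite /conj.
  have E c : x * (r * y * c * x) * (r * y) = (x * r * y) * c * (x * r * y).
    by rewrite !mulrA.
  by rewrite !E !xry !mul1r !mulr1.
have conj0 : conj 0 = 0 by rewrite /conj mulr0 mul0r.
pose e := conj 1.
have ee : e * e = e by rewrite conjM mulr1.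
exists e; first by rewrite /e /conj mulr1 -mulrA -[_ * _]addr0; apply: (Ir (y * x)).
split=> //; clearbody conj.
apply: (@prec_of_retraction _ _ _ (@principal_mul e e (conj v))
  (@principal_mul e e (conj w)) (to_principal e (conj (1 - v * w)))).
- move=> z; apply: from_principal_inj; 
  rewrite -[LHS]/(e * (conj w * (e * (conj v * from_principal z)))).
  by rewrite /e !mulrA !conjM mul1r mulr1 wv from_principalE.
- apply: contra_neq vw => /(congr1 (@from_principal T e)); rewrite to_principalK.
  rewrite conjM mul1r -[from_principal 0]/(0 : T) -[RHS]conj0 => /conj_inj/eqP.
  by rewrite subr_eq0 => /eqP.
- apply: from_principal_inj.
  rewrite -[LHS]/(e * (conj w * (e * conj (1 - v * w)))) -[RHS]/(0 : T).
  by rewrite /e !conjM !mul1r mulrBr mulr1 mulrA wv mul1r subrr conj0.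
Qed.

End PurelyInfinite.

Theorem theorem5p3 (A : pzRingType) (G : groupType) (inS : pred G)
  (S : subMonoidType inS)
  (hG : forall g : G, exists s t : S, g = ((val s)^-1 * val t)%g)
  (alpha : S -> {additive A -> A})
  (halpha : corner_action alpha)
  (A_simple : simple_ring A)
  (A_unperf : strictly_unperforated A)
  (A_idem : right_ideals_have_idempotents A)
  (alpha_outer : outer_action alpha)
  (alpha_proper : exists u : S, alpha u 1 != 1)
  (R : pzRingType) (phi : {rmorphism A -> R}) (minus plus : S -> R)
  (hR : is_skew_monoid_ring alpha phi minus plus) :
  purely_infinite_simple R.
Proof.
have [A1 _] := A_simple; have [u pu] := alpha_proper; have [rel univ] := hR.
have ore s t : exists x y : S, (x * s = y * t)%g.
  (* Writing the right fraction of [s] by [t] as a left fraction gives the Ore condition. *)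
  have [x [y xy]] := hG (val s * (val t)^-1)%g; exists x, y.
  by apply: val_inj; rewrite !gmulfM /= -[val y](mulKg (val x)^-1%g) -xy invgK mulgA mulgVK.
have R1 : (1 : R) != 0.
  have [f _] := univ _ _ _ _ (germ_skew_relations ore halpha).
  apply: contra_neq (germ_one_neq0 ore halpha A1) => R10.
  by rewrite -(rmorph1 f) R10 rmorph0.
(* If [phi a] were [0], so would be the image of [1], a sum of multiples of [a]. *)
have phi0 a : a != 0 -> phi a != 0.
  move=> /(simple_sum A_simple)[l l1]; apply: contra_neq R1 => pa0.
  rewrite -(rmorph1 phi) l1 rmorph_sum big1 // => r _.
  by rewrite !rmorphM pa0 mulr0 mul0r.
have minus_plus := skew_minus_plus rel; have plus_minus := skew_plus_minus rel.
apply: (purely_infinite_of_units (v := plus u) (w := minus u)) => //; last first.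
  rewrite plus_minus -subr_eq0 -(rmorph1 phi) -raddfB.
  by apply: phi0; rewrite subr_eq0.
move=> r r0.
have [s [l sr]] := skew_common_denominator rel halpha ore r hR.
have l0 : skew_polynomial phi plus l != 0.
  by apply: contra_neq r0 => l0; rewrite -[r]mul1r -(minus_plus s) -mulrA sr l0 mulr0.
have [t [a [l' [a0 l't lE]]]] := skew_polynomial_leading rel l0.
have at_ : a * alpha t 1 * alpha t 1 = a * alpha t 1.
  by rewrite -mulrA corner_unit_idem.
have [b [c [d0 bc]]] := outer_elimination halpha A_simple A_unperf A_idem
  alpha_outer pu a0 at_ l't.
set d := b * (a * alpha t 1) * alpha t c in d0.
have dE : phi b * (plus s * r) * phi c = phi d * plus t.
  rewrite sr lE mulrDr mulrDl [X in _ + X](_ : _ = 0) ?addr0; last first.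
    rewrite /skew_polynomial mulr_sumr mulr_suml big_seq big1 // => q ql.
    by rewrite mulrA -mulrA (skew_plusE rel) mulrA -!rmorphM bc // rmorph0 mul0r.
  rewrite mulrA -mulrA (skew_plusE rel) mulrA -!rmorphM /d.
  by rewrite -!mulrA corner_unitl.
have dt : d * alpha t 1 = d by rewrite /d -mulrA corner_unitr.
have [y [e0 ee]] := idempotent_right_multiple A_idem d0.
have [v [x' [y' [yx ex]]]] := corner_unit_subequivalent halpha A_simple A_unperf pu ee e0.
(* Between the outer factors, [phi b] and [phi c] leave [phi d * plus t]; [minus t] turns [plus t]
   into [phi (alpha t 1)], absorbed by [d]; then [y' * (d * y) * x' = alpha v 1], which [minus v]
   and [plus v] turn into [1]. *)
exists (minus v * phi y' * phi b * plus s), (phi c * minus t * phi y * phi x' * plus v).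
transitivity (minus v * phi y' * (phi b * (plus s * r) * phi c) * minus t * phi y * phi x' * plus v).
  by rewrite !mulrA.
transitivity (minus v * (phi y' * phi d * (plus t * minus t) * phi y * phi x') * plus v).
  by rewrite dE !mulrA.
rewrite plus_minus -!rmorphM -(mulrA y') dt -2!(mulrA y') ex yx -plus_minus.
by rewrite mulrA minus_plus mul1r minus_plus.
Qed.
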